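(* Fix $\delta>0$ and $\varepsilon>0$. Let $\lambda=(\lambda_1,\dots,\lambda_r)$ be a partition of $n$ with $\lambda_1=n-n^{\frac{2}{9}-\delta}$. If $f$ is generated by the random model $R(K,\mathcal C)$ with $K\le(1-\varepsilon)D_\lambda\log\log D_\lambda$, then with probability $1-o(1)$ as $n\to\infty$ the sparsest-fit algorithm applied to $\hat f(\lambda)$ recovers $f$.
   Context: $\log$ is the natural logarithm. $S_n$ is the symmetric group on $\{1,\dots,n\}$. For a partition $\lambda=(\lambda_1,\dots,\lambda_r)$ of $n$ ($\lambda_1\ge\dots\ge\lambda_r\ge1$), a $\lambda$-partition of $\{1,\dots,n\}$ is an ordered tuple $(B_1,\dots,B_r)$ of disjoint sets with $|B_i|=\lambda_i$ and union $\{1,\dots,n\}$; there are $D_\lambda=n!/\prod_i\lambda_i!$ of them, enumerated $t_1,\dots,t_{D_\lambda}$; $\sigma$ acts by $\sigma(B_1,\dots,B_r)=(\sigma(B_1),\dots,\sigma(B_r))$. $M^\lambda(\sigma)$ is the $D_\lambda\times D_\lambda$ $0/1$ matrix with $M^\lambda_{ij}(\sigma)=1$ iff $\sigma(t_j)=t_i$, and $\hat f(\lambda)=\sum_\sigma f(\sigma)M^\lambda(\sigma)$. Random model $R(K,\mathcal C)$: for fixed $\mathcal C=[a,b]$, $0<a<b$, choose $\sigma_1,\dots,\sigma_K$ i.i.d. uniform from $S_n$ (with replacement) and $p_1,\dots,p_K$ i.i.d. uniform on $\mathcal C$; $f(\sigma)=p_i$ if $\sigma=\sigma_i$, else $0$.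 Sparsest-fit algorithm: input the nonzero entries $q_1\le\dots\le q_L$ of $\hat f(\lambda)$ sorted ascending (with their matrix positions). Initialize $p_0=0$, $k(0)=0$, all $A_k=\emptyset$. For $\ell=1,\dots,L$: if $q_\ell=\sum_{k\in T}p_k$ for some $T\subseteq\{0,\dots,k(\ell-1)\}$, set $k(\ell)=k(\ell-1)$ and add $\ell$ to $A_k$ for $k\in T$; else set $k(\ell)=k(\ell-1)+1$, $p_{k(\ell)}=q_\ell$, add $\ell$ to $A_{k(\ell)}$. Output $(p_k,A_k)_{1\le k\le k(L)}$; each $A_k$ (a set of matrix positions) is read as the support of $M^\lambda(\sigma_k)$, giving a permutation $\sigma_k$ with value $p_k$. ''Recovers $f$'' means the resulting function equals $f$. *)

(* Defs.v *)
From HB Require Import structures.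
From mathcomp Require Import all_boot all_order all_algebra all_fingroup.
From mathcomp Require Import all_classical all_reals all_analysis.

Set Implicit Arguments.
Unset Strict Implicit.
Unset Printing Implicit Defensive.

Import Order.TTheory GRing.Theory Num.Theory.
Local Open Scope ring_scope.

Definition is_partition (n : nat) (lam : seq nat) : bool :=
  [&& sorted geq lam, all (fun x => 0 < x)%N lam & sumn lam == n].

(* An ordered tuple (B_1,...,B_r) is encoded by g : 'I_n -> 'I_r with
   x \in B_(g x); the block sizes must be lam_1,...,lam_r. *)
Definition tabloid_pred (n : nat) (lam : seq nat)
  (g : {ffun 'I_n -> 'I_(size lam)}) : bool :=
  [forall i : 'I_(size lam), #|[set x | g x == i]| == nth 0%N lam i].

Definition tabloid (n : nat) (lam : seq nat) :=
  {g : {ffun 'I_n -> 'I_(size lam)} | tabloid_pred g}.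

Definition Dlam (n : nat) (lam : seq nat) : nat := #|{: tabloid n lam}|.

(* action sigma (B_1,..,B_r) = (sigma B_1, .., sigma B_r):
   y \in sigma(B_i) iff sigma^-1 y \in B_i *)
Definition tab_act (n : nat) (lam : seq nat) (s : {perm 'I_n})
  (g : {ffun 'I_n -> 'I_(size lam)}) : {ffun 'I_n -> 'I_(size lam)} :=
  [ffun y => g ((s^-1)%g y)].

Definition Mentry (n : nat) (lam : seq nat) (s : {perm 'I_n})
  (x y : tabloid n lam) : bool := val x == tab_act s (val y).

Definition pos (n : nat) (lam : seq nat) := (tabloid n lam * tabloid n lam)%type.

Definition Msupp (n : nat) (lam : seq nat) (s : {perm 'I_n}) : {set pos n lam} :=
  [set xy | Mentry s xy.1 xy.2].

Definition hatf (R : realType) (n : nat) (lam : seq nat) (f : {perm 'I_n} -> R)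
  (xy : pos n lam) : R :=
  \sum_(s : {perm 'I_n}) f s * (Mentry s xy.1 xy.2)%:R.

(* state: the list of (p_k, A_k), k = 1..k(l) *)
Definition sf_state (R : realType) (n : nat) (lam : seq nat) :=
  seq (R * {set pos n lam}).

(* one step of the algorithm on input entry (x, q); subsets T are
   encoded by masks m over the current list of p_k's. *)
Definition sf_step (R : realType) (n : nat) (lam : seq nat)
  (st : sf_state R n lam) (e : pos n lam * R) (st' : sf_state R n lam) : Prop :=
  (exists m : bitseq, size m = size st /\
     e.2 = \sum_(c <- mask m st) c.1 /\
     st' = [seq (if bc.1 then (bc.2.1, e.1 |: bc.2.2) else bc.2) | bc <- zip m st])
  \/
  ((forall m : bitseq, size m = size st -> e.2 <> \sum_(c <- mask m st) c.1) /\
     st' = rcons st (e.2, [set e.1])).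

Inductive sf_run (R : realType) (n : nat) (lam : seq nat) :
  sf_state R n lam -> seq (pos n lam * R) -> sf_state R n lam -> Prop :=
| sf_run_nil st : sf_run st [::] st
| sf_run_cons st e es st' st'' :
    sf_step st e st' -> sf_run st' es st'' -> sf_run st (e :: es) st''.

Definition sorted_listing (R : realType) (n : nat) (lam : seq nat)
  (h : pos n lam -> R) (L : seq (pos n lam)) : Prop :=
  [/\ uniq L, (forall x, (x \in L) = (h x != 0)) & sorted (fun x y => h x <= h y) L].

Definition recovered (R : realType) (n : nat) (lam : seq nat)
  (f : {perm 'I_n} -> R) (st : sf_state R n lam) : Prop :=
  exists tau : seq {perm 'I_n},
    [/\ size tau = size st, uniq tau,
        (forall k, (k < size st)%N -> (nth (0, @finset.set0 (pos n lam)) st k).2 = Msupp lam (nth 1%g tau k))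
      & forall s, f s = if s \in tau then (nth (0, @finset.set0 (pos n lam)) st (index s tau)).1 else 0].

(* sparsest fit applied to \hat f(lam) recovers f (for every admissible
   sorted input order and every admissible choice of T in the algorithm) *)
Definition sf_recovers (R : realType) (n : nat) (lam : seq nat)
  (f : {perm 'I_n} -> R) : Prop :=
  forall L st, sorted_listing (hatf (lam:=lam) f) L ->
    sf_run [::] [seq (x, hatf (lam:=lam) f x) | x <- L] st -> recovered (lam:=lam) f st.

Definition model_f (R : realType) (n K : nat) (sig : {ffun 'I_K -> {perm 'I_n}})
  (ps : seq R) (s : {perm 'I_n}) : R :=
  let i := find (fun k : 'I_K => sig k == s) (enum 'I_K) in
  if (i < K)%N then nth 0 ps i else 0.

(* E[F(p_1,...,p_k)] for p_1,...,p_k i.i.d. uniform on [a,b] *)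
Fixpoint unif_iter (R : realType) (a b : R) (k : nat) (F : seq R -> \bar R) : \bar R :=
  match k with
  | 0 => F [::]
  | k'.+1 => ((b - a)^-1)%:E *
      \int[@lebesgue_measure R]_(x in `[a, b]) unif_iter a b k' (fun s => F (x :: s))
  end.

Definition prob_recover (R : realType) (a b : R) (n : nat) (lam : seq nat) (K : nat) : R :=
  (n`!%:R ^+ K)^-1 *
  \sum_(sig : {ffun 'I_K -> {perm 'I_n}})
     fine (unif_iter a b K (fun ps => ((asbool (sf_recovers lam (model_f sig ps)))%:R)%:E)).

(* Main.v *)
(* If the nonzero values of [f] have pairwise distinct subset sums and every
   permutation of the support has a witness, i.e. an entry of [hat f(lam)] to
   which it alone contributes, then sparsest fit succeeds: an entry that is a sum
   of several values exceeds each of them, so the corresponding witnesses were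
   processed before. Distinct subset sums hold almost surely.

   Let [m = n - lam_1], [D = D_lam] and [L ~ 3 (ln D)^2]. Choose [L] tabloids
   [t_j] whose sets of elements outside the first row are disjoint. After dividing
   by [sigma_k], the permutation [sigma_k] lacks a witness only if each [t_j] is
   fixed by one of [K] independent uniform permutations. Whatever a permutation
   does to the other tabloids, it fixes [t_j] with conditional probability at most
   [1/(d - L)], where [d >= D (1 - L m^2 / n) - 1] bounds from below the number of
   tabloids that are first-row on [L m] given elements. Hence the failure
   probability of [sigma_k] is at most [(1 - (1 - 1/(d-L))^K)^L]. For
   [K <= (1 - eps) D ln ln D] this is at most
   [(1 - 1/ln D)^L <= exp (- L / ln D) <= D^-3], and the union bound over [k]
   leaves [1/D]. *)
Require Import Defs.
From HB Require Import structures.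
From mathcomp Require Import all_boot all_order all_algebra all_fingroup.
From mathcomp Require Import all_classical all_reals all_analysis.
From mathcomp Require Import ring lra zify.

Set Implicit Arguments.
Unset Strict Implicit.
Unset Printing Implicit Defensive.

Import Order.TTheory GRing.Theory Num.Theory.
Import numFieldNormedType.Exports.
Local Open Scope ring_scope.

(** * Correctness of sparsest fit *)

(** Without duplicates, the bit at a position is determined by the element there. This turns the
    choice of [T] made by the algorithm into a set of permutations. *)
Lemma mask_indicator (T : eqType) (m : bitseq) (s : seq T) :
  uniq s -> size m = size s -> m = [seq x \in mask m s | x <- s].
Proof.
elim: s m => [|x s IH] [|b m] //= /andP[xs us] [sz].
congr cons.
  case: b; first by rewrite mem_head.
  by apply/esym/negbTE; apply: contra xs => /mem_mask.
rewrite {1}(IH m us sz); apply/eq_in_map => y ys.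
case: b => //; rewrite inE; case: eqP => // yx.
by move: xs; rewrite -yx ys.
Qed.

Lemma zip_map2 (T A B : Type) (f : T -> A) (g : T -> B) (s : seq T) :
  zip [seq f x | x <- s] [seq g x | x <- s] = [seq (f x, g x) | x <- s].
Proof. by elim: s => //= x s ->. Qed.

Section SparsestFit.
Variables (R : realType) (n : nat) (lam : seq nat) (f : {perm 'I_n} -> R).
Hypothesis f_ge0 : forall s, 0 <= f s.
Hypothesis subset_sum_inj : forall A B : {set {perm 'I_n}},
  {in A, forall s, f s != 0} -> {in B, forall s, f s != 0} ->
  \sum_(s in A) f s = \sum_(s in B) f s -> A = B.
Hypothesis unique_witness : forall s, f s != 0 ->
  exists2 x, x \in Msupp lam s &
    forall s', f s' != 0 -> x \in Msupp lam s' -> s' = s.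

Let hf := hatf (lam := lam) f.

Definition hits (x : pos n lam) : {set {perm 'I_n}} :=
  [set s | (f s != 0) && (x \in Msupp lam s)].

Lemma hits_neq0 x : {in hits x, forall s, f s != 0}.
Proof. by move=> s; rewrite inE => /andP[]. Qed.

Lemma hatf_sum x : hf x = \sum_(s in hits x) f s.
Proof.
rewrite /hf /hatf [RHS]big_mkcond /=; apply: eq_bigr => s _.
rewrite !inE; case: eqP => [->|_] /=; first by rewrite mul0r.
by case: Mentry; rewrite ?mulr1 ?mulr0.
Qed.

Lemma le_hatf {s x} : s \in hits x -> f s <= hf x.
Proof. by move=> sx; rewrite hatf_sum (bigD1 s) //= lerDl sumr_ge0. Qed.

(* After processing [P], the state lists, for pairwise distinct permutations of
   the support, the value and the processed part of the matrix support, and it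
   contains every permutation contributing to a processed entry. *)
Definition sf_inv (P : seq (pos n lam)) (st : sf_state R n lam) : Prop :=
  exists tau : seq {perm 'I_n},
    [/\ uniq tau, {in tau, forall s, f s != 0},
        st = [seq (f s, [set x in P] :&: Msupp lam s) | s <- tau]
      & {in P, forall x, {subset hits x <= tau}}].

Lemma sum_mask_state (g : {perm 'I_n} -> {set pos n lam}) tau m : uniq tau ->
  \sum_(c <- mask m [seq (f s, g s) | s <- tau]) c.1 =
  \sum_(s in [set s in mask m tau]) f s.
Proof.
move=> ut; rewrite -map_mask big_map /=.
rewrite big_uniq /=; last exact: mask_uniq.
by apply: eq_bigl => s; rewrite !inE.
Qed.

Lemma sf_inv_step (P rest : seq (pos n lam)) x st st' :
  sorted_listing hf (P ++ x :: rest) ->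
  sf_inv P st -> sf_step st (x, hf x) st' -> sf_inv (rcons P x) st'.
Proof.
move=> [uL memL sL] [tau [ut tau0 -> Ptau]] step.
have inA z s : (z \in [set y in rcons P x] :&: Msupp lam s) =
   ((z == x) || (z \in P)) && (z \in Msupp lam s).
  by rewrite !inE mem_rcons inE.
case: step => /=.
  move=> [m [sm [hm ->]]]; rewrite size_map in sm.
  rewrite sum_mask_state // hatf_sum in hm.
  have htau : {in [set s in mask m tau], forall s, f s != 0}.
    by move=> s; rewrite inE => /mem_mask /tau0.
  (* Distinct subset sums force the selected permutations to be exactly those contributing to the
     entry at [x]. *)
  move/subset_sum_inj: hm => /(_ (@hits_neq0 x) htau) hx.
  exists tau; split => //.
    rewrite [m](mask_indicator ut sm) zip_map2 -map_comp.
    apply/eq_in_map => s st_ /=.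
    have -> : (s \in mask m tau) = (s \in hits x) by rewrite hx inE.
    rewrite inE (tau0 s st_) /=.
    case: ifP => xs; congr pair; apply/setP => z; rewrite inA !inE.
      by case: eqP => [->|] //=; move: xs; rewrite inE => ->.
    by case: eqP => [->|] //=; move: xs; rewrite inE => ->; rewrite andbF.
  move=> z; rewrite mem_rcons inE => /orP[/eqP-> s|/Ptau//].
  by rewrite hx inE => /mem_mask.
move=> [nomask ->].
(* If all of [hits x] were listed in [tau], its indicator would be a mask representing the entry; so
   some contributing [s] is new. *)
have xnotin : ~~ all (mem tau) (enum (hits x)).
  apply/negP => /allP sub.
  apply: (nomask [seq s \in hits x | s <- tau]); first by rewrite !size_map.
  rewrite sum_mask_state // -filter_mask hatf_sum; apply: eq_bigl => s.
  rewrite [in RHS]inE mem_filter; case sx : (s \in hits x) => //=.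
  by apply/esym/sub; rewrite mem_enum.
have {xnotin} [s sx st_] : exists2 s, s \in hits x & s \notin tau.
  by case/allPn: xnotin => s; rewrite mem_enum; exists s.
have fs0 : f s != 0 by move: sx; rewrite inE => /andP[].
have xs : x \in Msupp lam s by move: sx; rewrite inE => /andP[].
(* The witness [w] of [s] has entry [f s] and is not in [P], since [s] is not in [tau]. Sortedness
   gives [hf x <= f s], while [s] contributes to [x], so equality holds and [s] is alone at [x]. *)
have hitsx : hits x = [set s].
  have [w ws wu] := unique_witness fs0.
  have hitsw : hits w = [set s].
    apply/setP => t; rewrite finset.in_set1 inE; apply/andP/eqP => [[t0 wt]|->//].
    exact: wu.
  have hw : hf w = f s by rewrite hatf_sum hitsw big_set1.
  have wL : w \in P ++ x :: rest by rewrite memL hw.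
  have xw : hf x <= f s.
    rewrite -hw; move: wL; rewrite mem_cat => /orP[wP|].
      by move: st_; rewrite (Ptau w) // hitsw set11.
    rewrite inE => /orP[/eqP->//|wr].
    have tr : transitive (fun x y => hf x <= hf y) by move=> a b c; exact: le_trans.
    have := drop_sorted (size P) sL; rewrite drop_size_cat //= => pth.
    by have /allP/(_ _ wr) := order_path_min tr pth.
  apply: subset_sum_inj (@hits_neq0 x) _ _; first by move=> t /set1P->.
  rewrite big_set1 -hatf_sum; apply/eqP; rewrite eq_le xw; exact: le_hatf.
have xP : x \notin P.
  by move: uL; rewrite cat_uniq /= negb_or => /and3P[_ /andP[]].
exists (rcons tau s); split.
- by rewrite rcons_uniq st_.
- by move=> t; rewrite mem_rcons inE => /orP[/eqP->|/tau0].
- rewrite map_rcons; congr rcons.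
    apply/eq_in_map => t tt; congr pair; apply/setP => z; rewrite inA !inE.
    case: eqP => [zx|] //=; rewrite zx (negbTE xP) /=.
    apply/esym/negP => xt.
    have : t \in hits x by rewrite !inE (tau0 t tt).
    by rewrite hitsx => /set1P ts; rewrite -ts tt in st_.
  congr pair; first by rewrite hatf_sum hitsx big_set1.
  apply/setP => z; rewrite inA !inE; case: eqP => [->|_] /=.
    by move: xs; rewrite inE => ->.
  apply/esym/negP => /andP[zP zs].
  by move: st_; rewrite (Ptau z) // !inE fs0.
- move=> z; rewrite mem_rcons inE => /orP[/eqP-> t|/Ptau zt t /zt].
    by rewrite hitsx => /set1P->; rewrite mem_rcons mem_head.
  by rewrite mem_rcons inE => ->; rewrite orbT.
Qed.

Lemma sf_inv_run L P st st' :
  sorted_listing hf (P ++ L) -> sf_inv P st ->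
  sf_run st [seq (x, hf x) | x <- L] st' -> sf_inv (P ++ L) st'.
Proof.
elim: L P st => [|x L IH] P st sL inv /= run.
  by inversion run; subst; rewrite cats0.
inversion run as [|? ? ? st1 ? step run1]; subst.
have inv1 := sf_inv_step sL inv step.
rewrite -cat_rcons in sL *; exact: IH sL inv1 run1.
Qed.

(** The witness of a permutation of the support is a nonzero entry, so it was processed and the
    permutation is listed in [tau]. *)
Lemma sparsest_fit_correct : sf_recovers lam f.
Proof.
move=> L st sL run.
have [tau [ut tau0 -> sub]] : sf_inv L st.
  apply: (@sf_inv_run L [::] [::]) => //.
  by exists [::]; split.
have [uL memL _] := sL.
have intau s : f s != 0 -> s \in tau.
  move=> fs0; have [w ws wu] := unique_witness fs0.
  have sw : s \in hits w by rewrite inE fs0.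
  apply: (sub w) => //; rewrite memL gt_eqF //.
  by apply: lt_le_trans (le_hatf sw); rewrite lt_def fs0 f_ge0.
exists tau; split => //; first by rewrite size_map.
  move=> k; rewrite size_map => kt; rewrite (nth_map 1%g) //=.
  set s := nth _ _ _; have st_ : s \in tau by rewrite mem_nth.
  (* Every entry in the matrix support of [s] is at least [f s > 0], hence it was processed. *)
  apply/setP => x; rewrite finset.in_setI andb_idl // => xs.
  rewrite inE memL gt_eqF //.
  have sx : s \in hits x by rewrite inE tau0.
  by apply: lt_le_trans (le_hatf sx); rewrite lt_def tau0 ?f_ge0.
move=> s; case: ifP => st_.
  by rewrite (nth_map 1%g) ?index_mem //= nth_index.
by apply/eqP; apply: contraFT st_ => /intau.
Qed.

End SparsestFit.

(** * Uniform values are generic *)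

Section UniformProduct.
Import measurable_realfun.
Variables (R : realType) (a b : R).
Hypothesis ab : a < b.
Local Open Scope classical_set_scope.
Local Open Scope ereal_scope.
Local Notation mu := (@lebesgue_measure R).

(* [F] need not be measurable, so the bounds on [unif_iter] rely on the integral
   of a nonnegative function being a supremum over simple functions below it. *)
Lemma ge0_le_integral_nonmeas d (T : measurableType d)
    (nu : {measure set T -> \bar R}) (D : set T) (f g : T -> \bar R) :
  (forall x, D x -> 0 <= f x) -> (forall x, D x -> f x <= g x) ->
  \int[nu]_(x in D) f x <= \int[nu]_(x in D) g x.
Proof.
move=> f0 fg; have g0 x : D x -> 0 <= g x.
  by move=> Dx; apply: le_trans (f0 _ Dx) (fg _ Dx).
rewrite !ge0_integralE //; apply: le_ereal_sup => _ /= [h hf <-].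
exists h => // x; apply: le_trans (hf x) _.
exact: lee_restrict.
Qed.

Lemma integral_itv1 : ((b - a)^-1)%:E * \int[mu]_(x in `[a, b]) cst 1 x = 1.
Proof.
rewrite integral_cst //= mul1e lebesgue_measure_itv /= lte_fin ab.
by rewrite -EFinD -EFinM mulVf // subr_eq0 gt_eqF.
Qed.

Lemma unif_iter_bounds k (F : seq R -> \bar R) :
  (forall s, 0 <= F s <= 1) -> 0 <= unif_iter a b k F <= 1.
Proof.
elim: k F => [|k IH] F F01 /=; first exact: F01.
have inner x : 0 <= unif_iter a b k (fun s => F (x :: s)) <= 1.
  by apply: IH => s; exact: F01.
have c0 : 0 <= ((b - a)^-1)%:E :> \bar R.
  by rewrite lee_fin invr_ge0 subr_ge0 ltW.
apply/andP; split.
  apply: mule_ge0 => //; apply: integral_ge0 => x _.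
  by case/andP: (inner x).
rewrite -[leRHS]integral_itv1; apply: lee_pmul => //.
  by apply: integral_ge0 => x _; case/andP: (inner x).
by apply: ge0_le_integral_nonmeas => x _; case/andP: (inner x).
Qed.

Lemma measurable_fun_ext_finite (f g : R -> \bar R) (l : seq R) (D : set R) :
  measurable D -> measurable_fun D g ->
  (forall x, D x -> x \notin l -> f x = g x) -> measurable_fun D f.
Proof.
elim: l D => [|y l IH] D mD mg fg.
  by apply: (eq_measurable_fun g) => // x; rewrite inE => Dx; rewrite fg.
have mDy : measurable (D `\ y) by apply: measurableD.
have mfy : measurable_fun (D `\ y) f.
  apply: IH => //; first by apply: measurable_funS mg => // x [].
  move=> x [Dx /= xy] xl; apply: fg => //; rewrite inE negb_or xl andbT.
  exact/eqP.
have [Dy|nDy] := pselect (D y); last by rewrite -(not_setD1 nDy).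
rewrite -(setD1K Dy); apply/measurable_funU => //; split => //.
exact: measurable_fun_set1.
Qed.

(** Single points are null sets, so the exceptional points are removed from [D] one at a time. *)
Lemma integral_ext_finite (f g : R -> \bar R) (l : seq R) (D : set R) :
  measurable D -> measurable_fun D g ->
  (forall x, D x -> x \notin l -> f x = g x) ->
  \int[mu]_(x in D) f x = \int[mu]_(x in D) g x.
Proof.
elim: l D => [|y l IH] D mD mg fg.
  by apply: eq_integral => x; rewrite inE => Dx; rewrite fg.
have mDy : measurable (D `\ y) by apply: measurableD.
have sub : D `\ y `<=` D by move=> x [].
have mgy := measurable_funS mD sub mg.
have mfy := measurable_funS mD sub (measurable_fun_ext_finite mD mg fg).
rewrite -(integral_setD1 mDy mfy) -(integral_setD1 mDy mgy).
apply: IH => //.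
move=> x [Dx /= xy] xl; apply: fg => //; rewrite inE negb_or xl andbT.
exact/eqP.
Qed.

(** Sets of positions are coded by boolean functions on [nat], so that one code serves both [s] and
    [rcons s x]. *)
Definition generic (s : seq R) : Prop :=
  [/\ forall i, (i < size s)%N -> (0 < nth 0 s i)%R &
   forall c c' : nat -> bool,
     (\sum_(i < size s | c i) nth 0 s i = \sum_(i < size s | c' i) nth 0 s i)%R ->
     forall i, (i < size s)%N -> c i = c' i].

(** A new value can create a coincidence only if it is a difference of two subset sums of [s]; [l]
    lists these finitely many differences. *)
Lemma generic_rcons (s : seq R) : generic s ->
  exists l : seq R, forall x, (0 < x)%R -> x \notin l -> generic (rcons s x).
Proof.
move=> [spos sgen].
pose S (c : {ffun 'I_(size s) -> bool}) : R := (\sum_(i < size s | c i) nth 0 s i)%R.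
exists [seq (S c.1 - S c.2)%R | c : {ffun 'I_(size s) -> bool} * {ffun 'I_(size s) -> bool}].
move=> x x0 xl.
have nthE (i : 'I_(size s)) : nth 0%R (rcons s x) i = nth 0%R s i.
  by rewrite nth_rcons ltn_ord.
split=> [i|c c'].
  rewrite size_rcons ltnS leq_eqVlt => /predU1P[->|il]; rewrite nth_rcons.
    by rewrite ltnn eqxx.
  by rewrite il spos.
have SE (e : nat -> bool) : (\sum_(i < size s | e i) nth 0 (rcons s x) i)%R =
    S [ffun i : 'I_(size s) => e i].
  by rewrite /S; apply: eq_big => [i|i _]; rewrite ?ffunE // nthE.
have bad (e e' : nat -> bool) : (S [ffun i : 'I_(size s) => e i] + x <> S [ffun i : 'I_(size s) => e' i])%R.
  move=> h; move/negP: xl; apply; apply/mapP.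
  exists ([ffun i : 'I_(size s) => e' i], [ffun i : 'I_(size s) => e i]).
    by rewrite mem_enum.
  by rewrite /= -h addrAC subrr add0r.
rewrite size_rcons big_mkcond [in RHS]big_mkcond /= !big_ord_recr /=.
rewrite -!big_mkcond /= !SE nth_rcons ltnn eqxx.
have sg : S [ffun i : 'I_(size s) => c i] = S [ffun i : 'I_(size s) => c' i] ->
    forall i, (i < size s)%N -> c i = c' i.
  move=> h; apply: sgen.
  transitivity (S [ffun i : 'I_(size s) => c i]).
    by apply: eq_bigl => i; rewrite ffunE.
  by rewrite h; apply: eq_bigl => i; rewrite ffunE.
have fin i : c (size s) = c' (size s) -> (forall i, (i < size s)%N -> c i = c' i) ->
    (i < (size s).+1)%N -> c i = c' i.
  by move=> h1 h2; rewrite ltnS leq_eqVlt => /predU1P[->|/h2].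
(* Cases by whether [x] occurs in each of the two sums: in both or neither it cancels, in exactly
   one it contradicts [bad]. *)
case cs : (c (size s)); case cs' : (c' (size s)).
- by move=> /addIr /sg h i; apply: fin => //; rewrite cs cs'.
- by rewrite addr0 => /bad.
- by rewrite addr0 => /esym /bad.
- by rewrite !addr0 => /sg h i; apply: fin => //; rewrite cs cs'.
Qed.

Hypothesis a0 : (0 < a)%R.

(** After a generic prefix, all but finitely many next values keep the prefix generic, so each
    successive average is an average of 1. *)
Lemma unif_iter_generic k (F : seq R -> \bar R) (s : seq R) : generic s ->
  (forall t, size t = (size s + k)%N -> generic t -> F t = 1) ->
  unif_iter a b k (fun t => F (s ++ t)) = 1.
Proof.
elim: k s => [|k IH] s gs F1 /=; first by rewrite cats0 F1 // addn0.
have [l sl] := generic_rcons gs.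
rewrite -[RHS]integral_itv1; congr (_ * _).
apply: (@integral_ext_finite _ _ l) => // x /=; rewrite in_itv /= => /andP[ax _] xl.
have gx : generic (rcons s x) by apply: sl => //; exact: lt_le_trans a0 ax.
rewrite -(IH (rcons s x) gx) => [|t]; last by rewrite size_rcons addSnnS; exact: F1.
by congr unif_iter; apply/funext => t; rewrite cat_rcons.
Qed.

Lemma unif_iter_generic0 k (F : seq R -> \bar R) :
  (forall t, size t = k -> generic t -> F t = 1) -> unif_iter a b k F = 1.
Proof.
by move=> F1; apply: (@unif_iter_generic k F [::]).
Qed.

End UniformProduct.

(** * Covering by independent samples *)

Section Covering.
Variables (R : realFieldType) (Om : finType) (K : nat) (q : R).
Hypothesis q01 : 0 <= q <= 1.

Lemma card_split_fiber (S : finType) (T : finType) (g : S -> T) (P : pred T) (Q : pred S) :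
  #|[pred s | P (g s) && Q s]| = (\sum_(t | P t) #|[pred s | (g s == t) && Q s]|)%N.
Proof.
rewrite -sum1_card (partition_big g P) /= => [|s /andP[]//].
apply: eq_bigr => t Pt; rewrite -sum1_card; apply: eq_bigl => s.
by rewrite !inE andbC; case: eqP => [->|] //=; rewrite Pt.
Qed.

Lemma card_ffun_prod (Q : 'I_K -> pred Om) :
  #|[pred sg : {ffun 'I_K -> Om} | [forall l, Q l (sg l)]]| = (\prod_l #|Q l|)%N.
Proof.
have -> : #|[pred sg : {ffun 'I_K -> Om} | [forall l, Q l (sg l)]]| = #|family Q|.
  by apply: eq_card => sg; rewrite [LHS]inE; apply/forallP/familyP => h x; exact: h.
by rewrite card_family foldrE big_image.
Qed.

(* Conditionally on the histories of all [K] coordinates, the coordinates stay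
   independent, so [E] occurs nowhere with probability at least [(1 - q) ^+ K]. *)
Lemma cover_step (H : finType) (hist : Om -> H) (E : pred Om)
    (P : pred {ffun 'I_K -> H}) :
  (forall h, #|[pred w | (hist w == h) && E w]|%:R <=
             q * #|[pred w | hist w == h]|%:R) ->
  #|[pred sg : {ffun 'I_K -> Om} |
      P [ffun l => hist (sg l)] && [exists l, E (sg l)]]|%:R <=
  (1 - (1 - q) ^+ K) *
  #|[pred sg : {ffun 'I_K -> Om} | P [ffun l => hist (sg l)]]|%:R.
Proof.
move=> hq; pose hs (sg : {ffun 'I_K -> Om}) := [ffun l => hist (sg l)].
have -> : #|[pred sg | P (hs sg)]| = #|[pred sg | P (hs sg) && true]|.
  by apply: eq_card => sg; rewrite !inE andbT.
rewrite (card_split_fiber hs P xpredT).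
rewrite (card_split_fiber hs P (fun sg => [exists l, E (sg l)])).
rewrite !natr_sum mulr_sumr; apply: ler_sum => h _.
set A := [pred sg | (hs sg == h) && true].
set B := [pred sg | (hs sg == h) && [exists l, E (sg l)]].
have hsE sg : (hs sg == h) = [forall l, hist (sg l) == h l].
  apply/eqP/forallP => [<- l|hl]; first by rewrite ffunE.
  by apply/ffunP => l; rewrite ffunE; apply/eqP.
(* [C] is the part of the fibre [A] over [h] where [E] never occurs. Both are products over the
   coordinates, so they are compared factor by factor. *)
pose C := [pred sg : {ffun 'I_K -> Om} |
  [forall l, (hist (sg l) == h l) && ~~ E (sg l)]].
have cardAB : (#|B| + #|C| = #|A|)%N.
  rewrite -(cardID [pred sg : {ffun 'I_K -> Om} | [exists l, E (sg l)]] A).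
  congr addn; apply: eq_card => sg; rewrite !inE ?andbT // andbC //.
  rewrite negb_exists hsE; apply/forallP/andP => [hl|[/forallP h1 /forallP h2] l].
    by split; apply/forallP => l; case/andP: (hl l).
  by rewrite h1 h2.
have cardA : #|A| = (\prod_l #|[pred w | hist w == h l]|)%N.
  rewrite -card_ffun_prod; apply: eq_card => sg; rewrite !inE andbT hsE.
  by [].
have q0 : 0 <= 1 - q by rewrite subr_ge0; case/andP: q01.
have cardC : (1 - q) ^+ K * #|A|%:R <= #|C|%:R.
  rewrite cardA (card_ffun_prod (fun l => [pred w | (hist w == h l) && ~~ E w])).
  rewrite !natr_prod -[X in _ ^+ X]card_ord -prodr_const -big_split /=.
  apply: ler_prod => l _; rewrite mulr_ge0 ?ler0n //=.
  have -> : #|[pred w | hist w == h l]| = (#|[pred w | (hist w == h l) && E w]| +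
     #|[pred w | (hist w == h l) && ~~ E w]|)%N.
    rewrite -(cardID E); congr addn; apply: eq_card => w; by rewrite !inE // andbC.
  have := hq (h l).
  have -> : #|[pred w | hist w == h l]| = (#|[pred w | (hist w == h l) && E w]| +
     #|[pred w | (hist w == h l) && ~~ E w]|)%N.
    rewrite -(cardID E); congr addn; apply: eq_card => w; by rewrite !inE // andbC.
  rewrite natrD; lra.
have : #|B|%:R = #|A|%:R - #|C|%:R :> R by rewrite -cardAB natrD addrK.
move=> ->; lra.
Qed.

Lemma cover_bound (F : nat -> pred Om) (L : nat) :
  (forall j, (j < L)%N -> forall h : {ffun 'I_j -> bool},
     #|[pred w | ([ffun i : 'I_j => F i w] == h) && F j w]|%:R <=
     q * #|[pred w | [ffun i : 'I_j => F i w] == h]|%:R) ->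
  #|[pred sg : {ffun 'I_K -> Om} | [forall j : 'I_L, [exists l, F j (sg l)]]]|%:R <=
  (1 - (1 - q) ^+ K) ^+ L * (#|Om| ^ K)%:R.
Proof.
elim: L => [|L IH] hF.
  rewrite expr0 mul1r ler_nat; apply: leq_trans (max_card _) _.
  by rewrite card_ffun card_ord.
have p0 : 0 <= 1 - (1 - q) ^+ K.
  rewrite subr_ge0 exprn_ile1 // ?subr_ge0; case/andP: q01 => //; lra.
have {}IH := IH (fun j jL => hF j (ltnW jL)).
rewrite exprS -mulrA; apply: le_trans (ler_wpM2l p0 IH).
(* The history of a coordinate records which of the first [L] events it satisfies; [P] says that
   each of these occurs at some coordinate. The event [F L] then contributes one more factor. *)
pose P (hh : {ffun 'I_K -> {ffun 'I_L -> bool}}) := [forall j, [exists l, hh l j]].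
apply: le_trans (le_trans (@cover_step _ _ (F L) P (hF L (ltnSn L))) _).
  rewrite ler_nat; apply/subset_leq_card/fintype.subsetP => sg; rewrite !inE => /forallP hj.
  apply/andP; split; last exact: (hj ord_max).
  apply/forallP => j; case/existsP: (hj (widen_ord (leqnSn L) j)) => l hl.
  by apply/existsP; exists l; rewrite !ffunE.
apply: ler_wpM2l => //; rewrite ler_nat.
apply/subset_leq_card/fintype.subsetP => sg; rewrite !inE => /forallP hj.
apply/forallP => j; case/existsP: (hj j) => l; rewrite !ffunE => hl.
by apply/existsP; exists l.
Qed.

End Covering.

(** * Tabloids and stabilizers *)

(** Equal fibre sizes make the two tuples of values rearrangements of each other. *)
Lemma fiber_perm (S : eqType) (n : nat) (f g : 'I_n -> S) :
  (forall c, #|[pred x | f x == c]| = #|[pred x | g x == c]|) ->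
  exists s : {perm 'I_n}, forall x, g (s x) = f x.
Proof.
move=> fg; have : perm_eq [tuple f i | i < n] [tuple g i | i < n].
  apply/allP => c _ /=; rewrite !count_map -!size_filter -!enumT /=.
  have cardE (h : 'I_n -> S) :
      size [seq x <- enum 'I_n | preim h (pred1 c) x] = #|[pred x | h x == c]|.
    by rewrite cardE enumT; congr size; rewrite /enum_mem -enumT; apply: eq_filter.
  by rewrite !cardE fg.
case/tuple_permP => s hs.
exists s => x; have /(congr1 (fun u => nth (f x) u x)) := hs.
rewrite (nth_map x) ?size_enum_ord // nth_ord_enum => ->.
by rewrite (nth_map x) ?size_enum_ord // nth_ord_enum tnth_mktuple.
Qed.

Section Tabloids.
Variables (n : nat) (lam : seq nat).
Local Notation T := (tabloid n lam).
Local Notation G := {perm 'I_n}.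
Local Notation m := (n - head 0 lam)%N.

Lemma tab_actM (s u : G) (g : {ffun 'I_n -> 'I_(size lam)}) :
  tab_act (s * u)%g g = tab_act u (tab_act s g).
Proof. by apply/ffunP => y; rewrite !ffunE invMg permM. Qed.

Lemma tab_actKV (s : G) (g : {ffun 'I_n -> 'I_(size lam)}) :
  tab_act s (tab_act s^-1%g g) = g.
Proof. by rewrite -tab_actM mulVg; apply/ffunP => y; rewrite ffunE invg1 perm1. Qed.

Lemma tab_act_inj (s : G) :
  injective (fun g : {ffun 'I_n -> 'I_(size lam)} => tab_act s g).
Proof.
move=> g h gh; rewrite -(tab_actKV s^-1%g g) -(tab_actKV s^-1%g h) invgK.
by rewrite gh.
Qed.

Lemma tab_act_pred (s : G) (t : T) : tabloid_pred (tab_act s (val t)).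
Proof.
case: t => g /= gP; apply/forallP => i; rewrite -(eqP (forallP gP i)); apply/eqP.
rewrite -[RHS](card_imset _ (@perm_inj _ s)); apply: eq_card => y.
apply/idP/imsetP => [|[x]]; rewrite !inE ?ffunE => h.
  by exists ((s^-1)%g y); rewrite ?inE // permKV.
by move=> ->; rewrite permK.
Qed.

Definition tact (s : G) (t : T) : T := Sub (tab_act s (val t)) (tab_act_pred s t).

Lemma tact_inj s : injective (tact s).
Proof. by move=> t u /(congr1 val) /tab_act_inj /val_inj. Qed.

(* Row index 0 is the first part of [lam]; [low t] is what lies outside it. *)
Definition low (t : T) : {set 'I_n} := [set x | val (val t x) != 0%N].

Lemma low_tact s t x : (x \in low (tact s t)) = ((s^-1)%g x \in low t).
Proof. by rewrite !inE ffunE. Qed.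

Lemma card_low t : #|low t| = m.
Proof.
case: t => g gP; rewrite /low /=.
have -> : [set x | val (g x) != 0%N] = ~: [set x | val (g x) == 0%N].
  by apply/setP => x; rewrite !inE.
rewrite cardsCs finset.setCK card_ord; congr subn.
have [r0|lt0] := posnP (size lam).
  have -> : head 0%N lam = 0%N by rewrite (size0nil r0).
  apply: eq_card0 => x.
  have lt0 := leq_ltn_trans (leq0n _) (ltn_ord (g x)).
  by exfalso; rewrite r0 in lt0.
have /forallP/(_ (Ordinal lt0))/eqP := gP; rewrite /= nth0 => <-.
by apply: eq_card => x; rewrite !inE.
Qed.

Lemma tabloid_transitive (W : {set 'I_n}) (t u : T) :
  [disjoint low t & W] -> [disjoint low u & W] ->
  exists s : G, {in W, forall x, s x = x} /\ tact s t = u.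
Proof.
move=> tW uW.
have z (v : T) : [disjoint low v & W] -> {in W, forall x, val (val v x) = 0%N}.
  move=> vW x xW; apply/eqP/negPn/negP => xv.
  by move: (disjointFl vW xW); rewrite inE xv.
(* Refining the labels to singletons on [W] forces the permutation to fix [W]. *)
pose ref (v : T) x := if x \in W then inl x else inr (val v x) : 'I_n + 'I_(size lam).
have cardW (v : T) c : #|[pred x | ref v x == inl c]| = (c \in W).
  case cW: (c \in W) => /=.
    rewrite -(card1 c); apply: eq_card => x; rewrite !inE /ref.
    case: ifP => xW; first by apply/eqP/eqP => [[]|->].
    by apply/esym/negP => /eqP xc; rewrite xc cW in xW.
  apply: eq_card0 => x; rewrite !inE /ref; case: ifP => // xW.
  by apply/eqP => -[xc]; rewrite xc cW in xW.
(* As [W] lies in the first row, removing it affects only the colour class 0, which loses [#|W|]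
   elements; the count is thus the same for [t] and [u]. *)
have cardN (v : T) c : [disjoint low v & W] ->
    #|[pred x | ref v x == inr c]| = (nth 0%N lam c - (val c == 0%N) * #|W|)%N.
  move=> vW; have zW := z v vW; have /forallP/(_ c)/eqP <- := valP v.
  rewrite -(cardsID W [set x | val v x == c]) addnC.
  have -> : #|[set x | val v x == c] :&: W| = ((val c == 0%N) * #|W|)%N.
    case: eqP => c0 /=; rewrite ?mul0n ?mul1n.
      apply: eq_card => x; rewrite !inE; case xW : (x \in W) => //; rewrite ?andbF //.
      by rewrite andbT; apply/eqP/val_inj; rewrite (zW x xW).
    apply: eq_card0 => x; rewrite !inE; apply/negP => /andP[/eqP gx xW].
    by apply: c0; rewrite -gx (zW x xW).
  rewrite addnK; apply: eq_card => x; rewrite !inE /ref.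
  by case: ifP => xW //; rewrite ?andbF.
have [|s hs] := @fiber_perm _ _ (ref t) (ref u).
  by case=> c; rewrite ?cardW // !cardN.
exists s; split => [x xW|].
  have := hs x; rewrite /ref xW; case: ifP => // _ [].
  by [].
apply/val_inj/ffunP => y; rewrite /= ffunE.
have := hs ((s^-1)%g y); rewrite permKV /ref.
case: ifP => yW; case: ifP => sW // [].
by move=> _; apply/val_inj; rewrite (z t tW) // (z u uW).
by move=> ->.
Qed.

(** These are the tabloids whose label function is zero on [W], that is, with [W] inside the first
    row. *)
Definition zeroes (W : {set 'I_n}) : {set T} := [set t | [disjoint low t & W]].

(** Transpositions make the count independent of [x]; then the pairs of an element and a tabloid
    with that element outside the first row are counted twice. *)
Lemma card_low_at x : (n * #|[set t : T | x \in low t]| = m * Dlam n lam)%N.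
Proof.
have cst y : #|[set t : T | y \in low t]| = #|[set t : T | x \in low t]|.
  rewrite -(card_imset _ (@tact_inj (tperm x y))); apply: eq_card => t.
  apply/imsetP/idP => [[u]|]; rewrite inE => h.
    by move=> ->; rewrite inE low_tact tpermV tpermL.
  exists (tact (tperm x y) t); first by rewrite inE low_tact tpermV tpermR.
  apply/val_inj; rewrite /= -tab_actM tperm2.
  by apply/ffunP => z; rewrite ffunE invg1 perm1.
rewrite -{1}(card_ord n) -sum_nat_const.
rewrite (eq_bigr (fun y => #|[set t : T | y \in low t]|)); last by move=> y _; rewrite cst.
rewrite (eq_bigr (fun y => \sum_(t : T) (y \in low t : nat))%N); last first.
  by move=> y _; rewrite -sum1_card big_mkcond; apply: eq_bigr => t _; rewrite inE; case: (_ \in _).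
rewrite exchange_big /= (eq_bigr (fun=> m)) => [|t _].
  by rewrite sum_nat_const mulnC.
by rewrite -(card_low t) -sum1_card [RHS]big_mkcond; apply: eq_bigr => y _; case: (_ \in _).
Qed.

(** Union bound over [x] in [W]: a proportion [m / n] of the tabloids has [x] outside the first
    row. *)
Lemma card_zeroes (W : {set 'I_n}) :
  (n * Dlam n lam <= n * #|zeroes W| + #|W| * (m * Dlam n lam))%N.
Proof.
have : (Dlam n lam <= #|zeroes W| + \sum_(x in W) #|[set t : T | x \in low t]|)%N.
  rewrite -sum1_card (eq_bigr (fun x => \sum_(t : T) (x \in low t : nat))%N); last first.
    by move=> y _; rewrite -sum1_card big_mkcond; apply: eq_bigr => t _; rewrite inE; case: (_ \in _).
  rewrite exchange_big /= [in X in (_ <= X + _)%N]big_mkcond -big_split /=.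
  rewrite /Dlam -sum1_card; apply: leq_sum => t _; rewrite inE.
  case: (boolP [disjoint _ & _]) => // /pred0Pn[x /andP[xt xW]].
  by rewrite add0n (bigD1 x) //= (_ : x \in low t).
move=> h; apply: leq_trans (leq_mul (leqnn n) h) _.
rewrite mulnDr leq_add2l big_distrr /= -sum_nat_const.
by apply: leq_sum => x _; rewrite card_low_at.
Qed.

(** Swapping a fixed element of [low t] with each of the [n - m] first-row elements gives distinct
    tabloids. *)
Lemma Dlam_ge (t : T) : (0 < m)%N -> (n - m <= Dlam n lam)%N.
Proof.
rewrite -(card_low t) => /card_gt0P[x xt].
rewrite -{1}(card_ord n) -cardsT -cardsDS ?finset.subsetT // finset.setTD.
have inj : {in ~: low t &, injective (fun y => tact (tperm x y) t)}.
  move=> y z; rewrite !finset.in_setC => yt zt yz.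
  have : y \in low (tact (tperm x z) t) by rewrite -yz low_tact tpermV tpermR.
  rewrite low_tact tpermV; case: tpermP => [yx|//|_ _].
    by rewrite yx xt in yt.
  by rewrite (negbTE yt).
by rewrite -(card_in_imset inj) /Dlam max_card.
Qed.

(** A tabloid [t] is determined by the images of the [m] elements of [low t0] under a chosen
    permutation [sg t] carrying [t0] to [t]. *)
Lemma Dlam_le : (Dlam n lam <= n ^ m)%N.
Proof.
rewrite /Dlam; case: (pickP (fun _ : T => true)) => [t0 _|T0]; last by rewrite eq_card0 // => t; have := T0 t.
have ex t : exists s, tact s t0 == t.
  have [||s [_ <-]] := @tabloid_transitive finset.set0 t0 t; last by exists s.
    by rewrite -setI_eq0 finset.setI0.
  by rewrite -setI_eq0 finset.setI0.
pose sg t := xchoose (ex t).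
have sgE t : tact (sg t) t0 = t by apply/eqP/(xchooseP (ex t)).
rewrite -(card_low t0) -[X in (X ^ _)%N]card_ord -(card_ord #|low t0|) -card_ffun.
pose phi t := [ffun i : 'I_#|low t0| => sg t (enum_val i)].
rewrite -(card_codom (f := phi)) ?max_card // => t u tu.
have sgx x : x \in low t0 -> sg t x = sg u x.
  move=> xt; move/ffunP/(_ (enum_rank_in xt x)): tu.
  by rewrite !ffunE enum_rankK_in.
have tE (v : T) z : val v z = val t0 ((sg v)^-1%g z).
  by rewrite -{1}(sgE v) /= ffunE.
have agree (v w : T) : (forall x, x \in low t0 -> sg v x = sg w x) ->
    forall y, y \in low v -> val v y = val w y.
  move=> vw y; rewrite -{1}(sgE v) low_tact => yv.
  have := vw _ yv; rewrite permKV => yw.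
  by rewrite (tE v) (tE w) [in RHS]yw permK.
apply/val_inj/ffunP => y.
case: (boolP (y \in low t)) => yt; first exact: agree.
case: (boolP (y \in low u)) => yu; first by apply/esym/agree => // x /sgx.
by move: yt yu; rewrite !inE !negbK => /eqP yt /eqP yu; apply/val_inj; rewrite yt yu.
Qed.

End Tabloids.

(** * Conditional probability of fixing a tabloid *)

Section Stabilizers.
Variables (n : nat) (lam : seq nat).
Local Notation T := (tabloid n lam).
Local Notation G := {perm 'I_n}.
Local Notation m := (n - head 0 lam)%N.

Definition fixes (t : T) : {set G} := [set s | tact s t == t].

Lemma tactM (s u : G) (t : T) : tact (s * u)%g t = tact u (tact s t).
Proof. by apply/val_inj; rewrite /= tab_actM. Qed.

Lemma fixes_pointwise (s : G) (t : T) :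
  {in low t, forall x, s x = x} -> s \in fixes t.
Proof.
move=> sx; rewrite inE; apply/eqP/val_inj/ffunP => y; rewrite /= ffunE.
set z := (s^-1)%g y; have -> : y = s z by rewrite permKV.
case: (boolP (z \in low t)) => [/sx->//|zt].
case: (boolP (s z \in low t)) => [szt|].
  by have /perm_inj szz := sx _ szt; rewrite szz (negbTE zt) in szt.
move: zt; rewrite !inE !negbK => /eqP zt /eqP szt.
by apply/val_inj; rewrite zt szt.
Qed.

(* Each [u \in zeroes W] is [tact s t] for some [s] fixing [W] pointwise, and
   right translation by [s] embeds the stabilizer of [t] in the fibre over [u]. *)
Lemma card_fixes_zeroes (A : {set G}) (W : {set 'I_n}) (t : T) :
  (forall s u : G, s \in A -> {in W, forall x, u x = x} -> (s * u)%g \in A) ->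
  t \in zeroes lam W ->
  (#|zeroes lam W| * #|A :&: fixes t| <= #|A|)%N.
Proof.
move=> AW; rewrite inE => tW.
rewrite -[#|A|]sum1_card.
apply: (@leq_trans (\sum_(u in zeroes lam W) #|[set s in A | tact s t == u]|)%N).
  rewrite -sum_nat_const; apply: leq_sum => u; rewrite inE => uW.
  have [s [sW su]] := tabloid_transitive tW uW.
  rewrite -(card_imset _ (mulIg s)); apply/subset_leq_card/fintype.subsetP => v.
  case/imsetP => w; rewrite !inE => /andP[wA /eqP wt] ->.
  by rewrite AW //= tactM wt su.
rewrite (eq_bigr (fun u => \sum_(s in A) (tact s t == u : nat))%N); last first.
  move=> u _; rewrite -sum1_card big_mkcond [RHS]big_mkcond /=.
  by apply: eq_bigr => s _; rewrite inE; case: (s \in A) => //=; case: eqP.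
rewrite exchange_big /=; apply: leq_sum => s _.
rewrite big_mkcond (bigD1 (tact s t)) //= big1 ?addn0.
  by case: ifP => // _; rewrite eqxx.
by move=> u /negbTE; rewrite eq_sym => ->; case: ifP.
Qed.

Variables (L d : nat).
Hypothesis zeroes_ge : forall W : {set 'I_n}, (#|W| <= L * m)%N -> (d <= #|zeroes lam W|)%N.

Lemma card_bigcup_low (t : nat -> T) (k : nat) (P : pred 'I_k) :
  (#|\bigcup_(i < k | P i) low (t i)| <= k * m)%N.
Proof.
apply: (@leq_trans (\sum_(i < k | P i) m)%N).
  elim/big_rec2: _ => [|i a B _ h]; first by rewrite cards0.
  rewrite -(card_low (t i)); apply: leq_trans (leq_card_setU _ _).1 _.
  by rewrite leq_add2l.
by rewrite sum_nat_const leq_mul2r (leq_trans (max_card _)) ?orbT // card_ord.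
Qed.

(** Greedy choice: fewer than [L] tabloids occupy at most [L * m] elements outside the first row, so
    one avoiding all of them remains. *)
Lemma disjoint_tabloids : (0 < d)%N ->
  exists t : nat -> T, forall i j, (i < j)%N -> (j < L)%N -> [disjoint low (t j) & low (t i)].
Proof.
move=> d0.
have [t0 _] : exists t0 : T, t0 \in zeroes lam finset.set0.
  by apply/card_gt0P; apply: leq_trans d0 (zeroes_ge _); rewrite cards0.
suff H k : (k <= L)%N -> exists t : nat -> T,
    forall i j, (i < j)%N -> (j < k)%N -> [disjoint low (t j) & low (t i)].
  exact: H.
elim: k => [|k IH] kL; first by exists (fun=> t0).
have [t tP] := IH (ltnW kL).
have [u] : exists u : T, u \in zeroes lam (\bigcup_(i < k | true) low (t i)).
  apply/card_gt0P; apply: leq_trans d0 (zeroes_ge _).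
  apply: leq_trans (card_bigcup_low _ _) _.
  by rewrite leq_mul2r (ltnW kL) orbT.
rewrite inE => uP; exists (fun i => if i == k then u else t i) => i j ij.
rewrite ltnS leq_eqVlt => /predU1P[jk|jk]; last first.
  by rewrite !ltn_eqF //; [exact: tP | exact: ltn_trans jk].
have ik : (i < k)%N by rewrite -jk.
rewrite jk eqxx ltn_eqF //; apply: disjointWr uP.
exact: (finset.bigcup_sup (Ordinal ik)).
Qed.

(** Keep first only the positive conditions of [h], which define [A]. Each other [t i], and [t j],
    is fixed by at most a proportion [1/d] of [A]. Imposing the negative conditions thus leaves at
    least [1 - L/d] of [A], and the quotient of the two bounds is [1/(d - L)]. *)
Lemma card_history (t : nat -> T) (j : nat) (h : {ffun 'I_j -> bool}) :
  (forall i j, (i < j)%N -> (j < L)%N -> [disjoint low (t j) & low (t i)]) ->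
  (j < L)%N ->
  (#|[pred s | ([ffun i : 'I_j => s \in fixes (t i)] == h) && (s \in fixes (t j))]| * (d - L)
   <= #|[pred s | [ffun i : 'I_j => s \in fixes (t i)] == h]|)%N.
Proof.
move=> tP jL; set N' := #|_|; set N := #|_|.
pose W := \bigcup_(i < j | h i) low (t i).
pose A := [set s | [forall i : 'I_j, h i ==> (s \in fixes (t i))]].
have AW (s u : G) : s \in A -> {in W, forall x, u x = x} -> (s * u)%g \in A.
  rewrite !inE => /forallP sA uW; apply/forallP => i; apply/implyP => hi.
  have := sA i; rewrite hi /= !inE tactM => /eqP ->.
  have := @fixes_pointwise u (t i); rewrite inE; apply => x xt; apply: uW.
  by apply/finset.bigcupP; exists i.
have dW : (d <= #|zeroes lam W|)%N.
  apply: zeroes_ge; apply: leq_trans (card_bigcup_low _ _) _.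
  by rewrite leq_mul2r (ltnW jL) orbT.
have bound k : t k \in zeroes lam W -> (d * #|A :&: fixes (t k)| <= #|A|)%N.
  move=> tk; apply: leq_trans (card_fixes_zeroes AW tk).
  by rewrite leq_mul2r dW orbT.
have disjW (v : T) : (forall i : 'I_j, h i -> [disjoint low v & low (t i)]) -> v \in zeroes lam W.
  move=> vt; rewrite inE; apply/bigcup_disjointP => i hi.
  exact: vt.
have N'A : (N' <= #|A :&: fixes (t j)|)%N.
  apply/subset_leq_card/fintype.subsetP => s; rewrite !inE => /andP[/eqP hs ->].
  by rewrite andbT; apply/forallP => i; rewrite -hs ffunE inE implybb.
have AN : (#|A| <= N + \sum_(i < j | ~~ h i) #|A :&: fixes (t i)|)%N.
  have <- : #|[set s | [ffun i : 'I_j => s \in fixes (t i)] == h]| = N.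
    by apply: eq_card => s; rewrite !inE.
  pose B := [set s | [ffun i : 'I_j => s \in fixes (t i)] == h].
  have : A \subset B :|: \bigcup_(i < j | ~~ h i) (A :&: fixes (t i)).
    apply/fintype.subsetP => s sA; rewrite finset.in_setU; case: (boolP (s \in B)) => //= sB.
    apply/finset.bigcupP; move: sB; rewrite inE => /eqP/ffunP sB.
    have /forallP sA' : [forall i : 'I_j, h i ==> (s \in fixes (t i))] by move: sA; rewrite inE.
    case: (pickP [pred i : 'I_j | ~~ h i && (s \in fixes (t i))]) => [i /andP[hi si]|none].
      by exists i => //; rewrite finset.in_setI sA si.
    exfalso; apply: sB => i; rewrite ffunE; have := none i; have := sA' i => /=.
    by case: (h i) => //= _; case: (s \in _).
  move=> /subset_leq_card /leq_trans; apply.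
  apply: leq_trans (leq_card_setU _ _).1 _; rewrite leq_add2l.
  elim/big_rec2: _ => [|i a C _ hh]; first by rewrite cards0.
  by apply: leq_trans (leq_card_setU _ _).1 _; rewrite leq_add2l.
have sumB : (d * \sum_(i < j | ~~ h i) #|A :&: fixes (t i)| <= L * #|A|)%N.
  rewrite big_distrr /=; apply: (@leq_trans (\sum_(i < j | ~~ h i) #|A|)%N).
    apply: leq_sum => i hi; apply/bound/disjW => k hk.
    have [ik|ki|ik] := ltngtP i k.
    - by rewrite disjoint_sym; apply: tP => //; apply: ltn_trans jL.
    - by apply: tP => //; apply: ltn_trans jL.
    - by rewrite (val_inj ik) hk in hi.
  rewrite sum_nat_const leq_mul2r (leq_trans (max_card _)) ?orbT // card_ord.
  exact: ltnW.
have b2 : (d * #|A :&: fixes (t j)| <= #|A|)%N by apply/bound/disjW => i _; exact: tP.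
move: (#|A|) (#|A :&: fixes (t j)|) (\sum_(i < j | _) _)%N AN N'A sumB b2 => a a' S AN N'A sumB b2.
(* For [d <= L] the truncated difference is 0 and the claim is trivial. *)
have [dL|Ld] := leqP d L; first by rewrite (eqnP dL) muln0.
have d0 : (0 < d)%N by apply: leq_ltn_trans Ld.
rewrite -(leq_pmul2l d0) mulnA.
apply: (@leq_trans (a * (d - L))%N).
  rewrite leq_mul2r; apply/orP; right; apply: leq_trans b2; by rewrite leq_mul2l N'A orbT.
by nia.
Qed.

End Stabilizers.

(* [isolated lam sig]: every [sig k] has a witness entry hit by no other [sig l];
   in particular [sig] is injective. *)
Definition isolated (n : nat) (lam : seq nat) (K : nat) (sig : {ffun 'I_K -> {perm 'I_n}}) : bool :=
  [forall k, [exists t : tabloid n lam, [forall l, (l != k) ==> (tact (sig l) t != tact (sig k) t)]]].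

(** Only [L] tabloids with disjoint [low] are tried as witnesses for each [sig k]; the union bound
    over [k] gives the factor [K]. *)
Lemma card_not_isolated (R : realFieldType) (n : nat) (lam : seq nat) (K L d : nat) :
  (forall W : {set 'I_n}, (#|W| <= L * (n - head 0 lam))%N -> (d <= #|zeroes lam W|)%N) ->
  (L < d)%N ->
  #|[pred sig : {ffun 'I_K -> {perm 'I_n}} | ~~ isolated lam sig]|%:R <=
  K%:R * ((1 - (1 - (d - L)%:R^-1) ^+ K) ^+ L * (n`! ^ K)%:R) :> R.
Proof.
move=> zd Ld; have [t tP] := disjoint_tabloids zd (leq_ltn_trans (leq0n _) Ld).
have dL0 : (0 < (d - L)%:R :> R) by rewrite ltr0n subn_gt0.
pose q : R := (d - L)%:R^-1.
have q01 : 0 <= q <= 1.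
  by rewrite invr_ge0 ler0n invf_le1 // ler1n subn_gt0.
pose F j : pred {perm 'I_n} := fun s => s \in fixes (t j).
have hF j : (j < L)%N -> forall h : {ffun 'I_j -> bool},
     #|[pred w | ([ffun i : 'I_j => F i w] == h) && F j w]|%:R <=
     q * #|[pred w | [ffun i : 'I_j => F i w] == h]|%:R.
  move=> jL h; rewrite mulrC ler_pdivlMr // -natrM ler_nat.
  exact: (card_history zd h tP jL).
have := cover_bound K q01 hF; rewrite card_Sn => cov.
apply: (@le_trans _ _ (\sum_(k < K) #|[pred sig : {ffun 'I_K -> {perm 'I_n}} |
   [forall j : 'I_L, [exists l, F j (sig l)]]]|%:R)); last first.
  by rewrite sumr_const card_ord -[leLHS]mulr_natl; apply: ler_wpM2l; rewrite ?ler0n.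
rewrite -natr_sum ler_nat.
pose B k := [set sig : {ffun 'I_K -> {perm 'I_n}} |
  ~~ [exists t : tabloid n lam, [forall l, (l != k) ==> (tact (sig l) t != tact (sig k) t)]]].
apply: (@leq_trans #|\bigcup_(k < K) B k|).
  apply/subset_leq_card/fintype.subsetP => sig; rewrite inE negb_forall => /existsP[k kP].
  by apply/finset.bigcupP; exists k => //; rewrite inE.
apply: (@leq_trans (\sum_(k < K) #|B k|)%N).
  elim/big_rec2: _ => [|i a C _ hh]; first by rewrite cards0.
  by apply: leq_trans (leq_card_setU _ _).1 _; rewrite leq_add2l.
apply: leq_sum => k _.
(* Dividing by [sig k] turns agreement with [sig k] on [t j] into fixing [t j]. *)
pose phi (sig : {ffun 'I_K -> {perm 'I_n}}) :=
  [ffun l => if l == k then sig k else (sig l * (sig k)^-1)%g].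
(* Coordinate [k] keeps [sig k], so the division can be undone. *)
have phi_inj : injective phi.
  move=> s1 s2 /ffunP e; apply/ffunP => l.
  have ek : s1 k = s2 k by have := e k; rewrite !ffunE eqxx.
  have := e l; rewrite !ffunE; case: eqP => [->//|_]; rewrite ek; exact: mulIg.
rewrite -(card_imset _ phi_inj); apply/subset_leq_card/fintype.subsetP => _ /imsetP[sig sigB ->].
rewrite inE; apply/forallP => j; move: sigB; rewrite inE negb_exists => /forallP/(_ (t j)).
rewrite negb_forall => /existsP[l]; rewrite negb_imply negbK => /andP[lk /eqP e].
apply/existsP; exists l; rewrite /F inE ffunE (negbTE lk) tactM e -tactM mulgV.
by apply/eqP/val_inj/ffunP => y; rewrite /= ffunE invg1 perm1.
Qed.

(** * The random model *)

Section Model.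
Variables (R : realType) (n : nat) (lam : seq nat) (ps : seq R).
Variable sig : {ffun 'I_(size ps) -> {perm 'I_n}}.
Hypothesis gen : generic ps.
Hypothesis iso : isolated lam sig.
Let f := model_f sig ps.

Lemma isolated_inj : injective sig.
Proof.
move=> l k lk; apply/eqP/negPn/negP => lnk.
have /existsP[t /forallP/(_ l)] := forallP iso k.
by rewrite lnk lk eqxx.
Qed.

Lemma model_f_sig k : f (sig k) = nth 0 ps k.
Proof.
rewrite /f /model_f; have -> : find (fun i => sig i == sig k) (enum 'I_(size ps)) = k.
  rewrite -[RHS]index_enum_ord /index; apply: eq_find => i /=.
  by rewrite (inj_eq isolated_inj).
by rewrite ltn_ord.
Qed.

Lemma model_f_supp s : f s != 0 -> exists k, s = sig k.
Proof.
rewrite /f /model_f; case: ifP => [h _|]; last by rewrite eqxx.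
have [/hasP[k _ /eqP<-]|/hasNfind e] :=
    boolP (has (fun k => sig k == s) (enum 'I_(size ps))); first by exists k.
by rewrite e size_enum_ord ltnn in h.
Qed.

Lemma model_f_gt0 k : 0 < f (sig k).
Proof. by rewrite model_f_sig; case: gen => + _; apply. Qed.

Lemma model_sum (S : {set {perm 'I_n}}) : {in S, forall s, f s != 0} ->
  \sum_(s in S) f s = \sum_(k | sig k \in S) nth 0 ps k.
Proof.
move=> S0; have -> : S = [set sig k | k in [set k | sig k \in S]].
  apply/setP => s; apply/idP/imsetP => [sS|[k]]; last by rewrite inE => ? ->.
  by have [k sk] := model_f_supp (S0 s sS); exists k; rewrite ?inE -?sk.
rewrite big_imset /=; last by move=> ? ? _ _; exact: isolated_inj.
apply: eq_big => [k|k _]; last exact: model_f_sig.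
rewrite inE; apply/idP/imsetP => [kS|[k']]; first by exists k; rewrite ?inE.
by rewrite inE => ? ->.
Qed.

Lemma model_recovers : sf_recovers lam f.
Proof.
apply: sparsest_fit_correct => [s|S S' S0 S0'|s /model_f_supp[k ->]].
- have [->//|/model_f_supp[k ->]] := eqVneq (f s) 0.
  exact/ltW/model_f_gt0.
- rewrite !model_sum // => SS'; case: gen => _ inj.
  (* Translates a set of permutations into the coding of positions used by [generic]. *)
  pose c (U : {set {perm 'I_n}}) (i : nat) := if insub i is Some k then sig k \in U else false.
  have cE U (k : 'I_(size ps)) : c U k = (sig k \in U) by rewrite /c valK.
  have sub (U U' : {set {perm 'I_n}}) : {in U, forall s, f s != 0} ->
      \sum_(k | sig k \in U) nth 0 ps k = \sum_(k | sig k \in U') nth 0 ps k ->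
      {subset U <= U'}.
    move=> U0 UU' s sU; have [k sk] := model_f_supp (U0 s sU).
    have <- : c U k = (s \in U') by
      rewrite (inj (c U) (c U')) ?cE -?sk //
        (eq_bigl _ _ (cE U)) UU' (eq_bigl _ _ (cE U')).
    by rewrite cE -sk.
  by apply/setP => s; apply/idP/idP; apply: sub.
have /existsP[t /forallP tP] := forallP iso k.
exists (tact (sig k) t, t); first by rewrite inE /Mentry /=.
move=> s' /model_f_supp[l ->]; rewrite inE /Mentry /= => e.
have := tP l; case: eqP => [->//|_ /=].
by rewrite -val_eqE /= eq_sym e.
Qed.

End Model.

(** * Bounds on the recovery probability *)

Section RecoveryProbability.
Variables (R : realType) (a b : R) (n : nat) (lam : seq nat) (K : nat).
Hypotheses (a0 : 0 < a) (ab : a < b).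
Local Notation F sig :=
  (fine (unif_iter a b K (fun ps => ((asbool (sf_recovers lam (model_f sig ps)))%:R)%:E))).

Lemma fine_unif_iter_le1 (G : seq R -> bool) :
  0 <= fine (unif_iter a b K (fun ps => ((G ps)%:R)%:E)) <= 1.
Proof.
have /andP[h0 h1] : (0 <= unif_iter a b K (fun ps => ((G ps)%:R)%:E) <= 1)%E.
  by apply: unif_iter_bounds => // s; case: (G s); rewrite !lee_fin lexx ?ler01.
rewrite fine_ge0 //= -lee_fin fineK // ge0_fin_numE //.
exact: le_lt_trans h1 (ltry _).
Qed.

Lemma fine_unif_iter_isolated (sig : {ffun 'I_K -> {perm 'I_n}}) :
  isolated lam sig -> F sig = 1.
Proof.
move=> iso; rewrite (@unif_iter_generic0 _ _ _ ab a0) //= => ps szps gps.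
rewrite asboolT //; move: sig iso; rewrite -szps => sig iso.
exact: model_recovers.
Qed.

Lemma prob_recover_le1 : prob_recover a b n lam K <= 1.
Proof.
rewrite /prob_recover mulrC ler_pdivrMr ?mul1r; last first.
  by rewrite exprn_gt0 // ltr0n fact_gt0.
apply: (@le_trans _ _ (\sum_(sig : {ffun 'I_K -> {perm 'I_n}}) 1)).
  by apply: ler_sum => sig _; case/andP: (fine_unif_iter_le1 (fun ps => asbool (sf_recovers lam (model_f sig ps)))).
by rewrite sumr_const card_ffun card_Sn card_ord natrX.
Qed.

(** Isolated choices of permutations contribute exactly 1 to the average, the others at least 0. *)
Lemma prob_recover_ge (eta : R) :
  #|[pred sig : {ffun 'I_K -> {perm 'I_n}} | ~~ isolated lam sig]|%:R <= eta * (n`! ^ K)%:R ->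
  1 - eta <= prob_recover a b n lam K.
Proof.
move=> h; have f0 : 0 < (n`!%:R ^+ K : R) by rewrite exprn_gt0 // ltr0n fact_gt0.
rewrite /prob_recover mulrC ler_pdivlMr // mulrBl mul1r -natrX.
apply: (@le_trans _ _ (#|[pred sig : {ffun 'I_K -> {perm 'I_n}} | isolated lam sig]|%:R)).
  have e : (#|[pred sig : {ffun 'I_K -> {perm 'I_n}} | isolated lam sig]| +
      #|[pred sig : {ffun 'I_K -> {perm 'I_n}} | ~~ isolated lam sig]|)%N = (n`! ^ K)%N.
    by rewrite cardC card_ffun card_Sn card_ord.
  by move: h; rewrite -{2}e natrD; lra.
rewrite -sum1_card natr_sum [leLHS]big_mkcond /=; apply: ler_sum => sig _.
rewrite inE; case: ifP => [/fine_unif_iter_isolated->//|_].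
by case/andP: (fine_unif_iter_le1 (fun ps => asbool (sf_recovers lam (model_f sig ps)))).
Qed.

End RecoveryProbability.

(** * Asymptotics *)

(** Here [e] plays the role of [d - L], and [y] is [ln D]. The loss [c / 2] in [e] is absorbed by
    the factor [1 - c] in the bound on [K]. *)
Lemma uncovered_bound (R : realType) (K L : nat) (D e y c : R) :
  1 <= y -> 0 < c -> c < 1 -> y <= D -> ln D = y -> 0 < D -> (1 - c / 2) * D + 1 <= e ->
  K%:R <= (1 - c) * D * ln y -> 3 * y ^+ 2 <= L%:R ->
  K%:R * (1 - (1 - e^-1) ^+ K) ^+ L <= D^-1.
Proof.
move=> y1 c0 c1 yD lnD D0 eD KD Ly.
have y0 : 0 < y by lra.
have cD : 0 < (1 - c / 2) * D by apply: mulr_gt0; lra.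
have u0 : 0 < e - 1 by lra.
have e0 : 0 < e by lra.
have lny : 0 <= ln y by exact: ln_ge0.
have Kq : K%:R / (e - 1) <= ln y.
  rewrite ler_pdivrMr //; apply: le_trans KD _.
  rewrite mulrC ler_wpM2l //; have := mulr_gt0 c0 D0; lra.
(* This is [1 + u <= expR u] at [u = (e - 1)^-1], after taking inverses. *)
have q1 : expR (- (e - 1)^-1) <= 1 - e^-1.
  rewrite expRN -[leRHS]invrK lef_pV2 ?posrE ?expR_gt0 ?invr_gt0 //; last first.
    by rewrite subr_gt0 invf_lt1 //; lra.
  have -> : (1 - e^-1)^-1 = 1 + (e - 1)^-1 by field; rewrite !gt_eqF.
  exact: expR_ge1Dx.
have p1 : y^-1 <= (1 - e^-1) ^+ K.
  apply: (@le_trans _ _ (expR (- (e - 1)^-1) ^+ K)).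
    rewrite -expRM_natl mulrN expRN lef_pV2 ?posrE ?expR_gt0 //.
    by rewrite -[leRHS](@lnK _ y) ?posrE // ler_expR.
  by apply: lerXn2r; rewrite ?nnegrE ?expR_ge0 //; apply: le_trans q1; rewrite expR_ge0.
have p2 : (1 - e^-1) ^+ K <= 1.
  apply: exprn_ile1; first by rewrite subr_ge0 invf_le1 //; lra.
  by rewrite gerBl invr_ge0 ltW.
have p3 : (1 - (1 - e^-1) ^+ K) ^+ L <= D ^- 3.
  apply: (@le_trans _ _ (expR (- y^-1) ^+ L)).
    apply: lerXn2r; rewrite ?nnegrE ?expR_ge0 ?subr_ge0 //.
    apply: le_trans (expR_ge1Dx _); lra.
  rewrite -expRM_natl -(@lnK _ D) ?posrE // lnD -expRM_natl -expRN ler_expR.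
  rewrite mulrN lerN2 ler_pdivlMr // -mulrA -expr2; exact: Ly.
have KD2 : K%:R <= D ^+ 2.
  apply: le_trans KD _; rewrite expr2 -mulrA [D * ln y]mulrC.
  have lnyD : ln y <= D by apply: le_trans yD; apply/ltW/ln_sublinear.
  have : ln y * D <= D * D by rewrite ler_wpM2r // ltW.
  have : 0 <= c * (ln y * D) by rewrite !mulr_ge0 // ltW.
  lra.
apply: (@le_trans _ _ (D ^+ 2 * D ^- 3)); last first.
  by rewrite (_ : D ^+ 2 * D ^- 3 = D^-1) //; field; rewrite gt_eqF.
by apply: ler_pM => //; rewrite ?ler0n // exprn_ge0 // subr_ge0.
Qed.

Lemma prob_recover_bound (R : realType) (a b c : R) (n : nat) (lam : seq nat) (K L : nat) :
  0 < a -> a < b -> 0 < c -> c < 1 -> (0 < n)%N ->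
  let m : R := (n - head 0 lam)%N%:R in
  let D : R := (Dlam n lam)%:R in
  1 <= ln D -> K%:R <= (1 - c) * D * ln (ln D) -> 3 * ln D ^+ 2 <= L%:R ->
  L%:R * m ^+ 2 / n%:R + (L%:R + 2) / D <= c / 2 ->
  1 - D^-1 <= prob_recover a b n lam K.
Proof.
move=> a0 ab c0 c1 n0 m D lnD KD Ly small.
have D0 : 0 < D by rewrite ltNge; apply/negP => /ln0 E; move: lnD; rewrite E; lra.
(* The integer part of [D (1 - L m^2 / n)], from [card_zeroes] with [#|W| <= L m]. *)
pose d := ((Dlam n lam * (n - L * (n - head 0 lam) ^ 2)) %/ n)%N.
have zd (W : {set 'I_n}) : (#|W| <= L * (n - head 0 lam))%N -> (d <= #|zeroes lam W|)%N.
  move=> cW; rewrite -(leq_pmul2l n0) mulnC; apply: leq_trans (leq_divM _ _) _.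
  rewrite mulnBr leq_subLR [(_ * n)%N]mulnC; apply: leq_trans (card_zeroes lam W) _.
  rewrite addnC leq_add2r; set k := (n - _)%N.
  have -> : (Dlam n lam * (L * k ^ 2) = L * k * (k * Dlam n lam))%N by rewrite -mulnn; ring.
  by rewrite leq_mul2r cW orbT.
have n0R : 0 < n%:R :> R by rewrite ltr0n.
have dD : D - D * (L%:R * m ^+ 2 / n%:R) < d%:R + 1.
  have h : (Dlam n lam * (n - L * (n - head 0 lam) ^ 2) < d.+1 * n)%N by rewrite ltn_ceil.
  have {}h : (Dlam n lam * n < d.+1 * n + Dlam n lam * (L * (n - head 0 lam) ^ 2))%N by nia.
  move: h; rewrite -(ltr_nat R) natrD !natrM -/m -/D -[d.+1]addn1 natrD => h.
  rewrite expr2 -(ltr_pM2r n0R) mulrBl -!mulrA mulVf ?mulr1; last by rewrite gt_eqF.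
  rewrite !mulrA in h *; lra.
(* Of the 2 in [L + 2], one unit pays for rounding in [d], the other for the [+ 1] here. *)
have eD : (1 - c / 2) * D + 1 <= d%:R - L%:R.
  have : (L%:R * m ^+ 2 / n%:R + (L%:R + 2) / D) * D <= c / 2 * D by rewrite ler_wpM2r // ltW.
  rewrite mulrDl divfK ?gt_eqF // [_ * D]mulrC; lra.
have Ld : (L < d)%N.
  rewrite -(ltr_nat R); have cD : 0 < (1 - c / 2) * D by apply: mulr_gt0; lra.
  lra.
rewrite -natrB in eD; last exact: ltnW.
have lnD_le : ln D <= D by apply/ltW/ln_sublinear.
apply: prob_recover_ge => //.
apply: le_trans (card_not_isolated R K zd Ld) _.
rewrite mulrA ler_wpM2r // ?ler0n //.
exact: (uncovered_bound lnD c0 c1 lnD_le erefl).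
Qed.

(* With [z = n^(1/36)], the bounds [m <= n^(2/9) = z^8] and [ln D <= m ln n]
   turn every error term into a power of [z]. *)
Lemma error_bound (R : realType) (c z m N D L : R) :
  0 < c -> 1 <= z -> 32 * 36 ^+ 2 / c <= z -> 0 <= m -> m <= z ^+ 8 -> N = z ^+ 36 ->
  1 <= ln D -> z ^+ 36 <= D * 2 -> ln D <= m * ln N -> 0 <= L -> L <= 3 * ln D ^+ 2 + 1 ->
  L * m ^+ 2 / N + (L + 2) / D <= c / 2.
Proof.
move=> c0 z1 cz m0 mz NE lnD zN lnDm L0 LD.
have z0 : 0 < z by lra.
have N0 : 0 < N by rewrite NE exprn_gt0.
have z36 : 0 < z ^+ 36 by rewrite exprn_gt0.
have D0 : 0 < D by lra.
have lnN : ln N <= 36 * z.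
  rewrite NE lnXn // -[leLHS]mulr_natl ler_wpM2l //.
  exact/ltW/ln_sublinear.
have lnDz : ln D <= 36 * z ^+ 9.
  apply: le_trans lnDm _; rewrite exprSr mulrCA.
  apply: ler_pM => //; apply: ln_ge0; rewrite NE; exact: exprn_ege1.
pose A : R := 36 ^+ 2; have A0 : 0 < A by rewrite exprn_gt0.
have lnD2 : ln D ^+ 2 <= A * z ^+ 18.
  have -> : A * z ^+ 18 = (36 * z ^+ 9) ^+ 2 by rewrite exprMn -exprM.
  by rewrite lerXn2r // nnegrE; lra.
have lnD1 : 1 <= ln D ^+ 2 by exact: exprn_ege1.
have m2 : m ^+ 2 <= z ^+ 16.
  by rewrite -[16%N]/(8 * 2)%N exprM lerXn2r // nnegrE exprn_ge0 // ltW.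
have t1 : L * m ^+ 2 / N <= 4 * A / z.
  rewrite ler_pdivrMr // NE; apply: (@le_trans _ _ (4 * A * z ^+ 18 * z ^+ 16)).
    by apply: ler_pM => //; rewrite ?exprn_ge0 //; lra.
  have -> : 4 * A / z * z ^+ 36 = 4 * A * z ^+ 35 by field; rewrite gt_eqF.
  rewrite -mulrA -exprD ler_wpM2l //; first lra.
  exact: ler_weXn2l.
(* Since [ln D >= 1], [L + 2 <= 6 (ln D)^2]; the bound [D >= z^36 / 2] doubles the constant. *)
have t2 : (L + 2) / D <= 12 * A / z.
  rewrite ler_pdivrMr //; apply: (@le_trans _ _ (6 * A * z ^+ 18)); first lra.
  apply: (@le_trans _ _ (6 * A / z * z ^+ 36)).
    have -> : 6 * A / z * z ^+ 36 = 6 * A * z ^+ 35 by field; rewrite gt_eqF.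
    rewrite ler_wpM2l //; first lra.
    exact: ler_weXn2l.
  have -> : 12 * A / z * D = 6 * A / z * (D * 2) by field; rewrite gt_eqF.
  rewrite ler_wpM2l // divr_ge0 //; lra.
have : 16 * A / z <= c / 2.
  rewrite ler_pdivrMr //; have : 32 * A / c * c <= z * c by rewrite ler_wpM2r // ltW.
  rewrite divfK ?gt_eqF //; lra.
have -> : 16 * A / z = 4 * A / z + 12 * A / z by field; rewrite gt_eqF.
lra.
Qed.

Lemma expR1_le4 (R : realType) : expR 1 <= 4 :> R.
Proof.
have h : 2^-1 <= expR (- 2^-1) :> R by apply: le_trans (expR_ge1Dx _); lra.
have -> : expR 1 = (expR (- 2^-1)) ^- 2 :> R.
  by rewrite -expRM_natl -expRN; congr expR; field.
have -> : 4 = (2^-1) ^- 2 :> R by field.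
rewrite lef_pV2 ?posrE ?exprn_gt0 ?expR_gt0 ?invr_gt0 //.
by rewrite lerXn2r // nnegrE ?expR_ge0 ?invr_ge0.
Qed.

Local Open Scope classical_set_scope.

Theorem theorem5 (R : realType) (delta eps a b : R)
  (hdelta : 0 < delta) (heps : 0 < eps) (ha : 0 < a) (hab : a < b)
  (lam : nat -> seq nat) (K : nat -> nat)
  (hlam : forall n, is_partition n (lam n))
  (hlam1 : \forall n \near \oo,
      ((n - head 0 (lam n))%N%:R <= (n%:R : R) `^ (2 / 9 - delta)) /\
      ((n%:R : R) `^ (2 / 9 - delta) < (n - head 0 (lam n)).+1%:R))
  (hK : \forall n \near \oo,
      ((K n)%:R : R) <= (1 - eps) * (Dlam n (lam n))%:R * ln (ln (Dlam n (lam n))%:R)) :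
  prob_recover a b n (lam n) (K n) @[n --> \oo] --> (1 : R).
Proof.
apply/cvgrPdist_le => eta eta0.
(* Capping [eps] keeps [1 - c] positive; the bound on [K] persists because [c <= eps]. *)
pose c : R := Num.min eps 2^-1.
have c0 : 0 < c by rewrite lt_min heps /=; lra.
have c1 : c < 1 by rewrite gt_min; apply/orP; right; lra.
(* The three summands serve [n - m >= n / 2], the smallness required by [error_bound], and
   [1 / D <= eta]. *)
pose M : R := 8 + 32 * 36 ^+ 2 / c + 2 / eta.
have cpos : 0 < 32 * 36 ^+ 2 / c by rewrite divr_gt0.
have etapos : 0 < 2 / eta by rewrite divr_gt0.
near=> n.
have [hm _] : ((n - head 0 (lam n))%N%:R <= (n%:R : R) `^ (2 / 9 - delta)) /\
      ((n%:R : R) `^ (2 / 9 - delta) < (n - head 0 (lam n)).+1%:R) by near: n.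
have hKn : ((K n)%:R : R) <= (1 - eps) * (Dlam n (lam n))%:R * ln (ln (Dlam n (lam n))%:R).
  by near: n.
have nM : M ^+ 36 <= n%:R :> R by near: n; exact: nbhs_infty_ger.
have p1 := prob_recover_le1 n (lam n) (K n) hab.
rewrite ger0_norm ?subr_ge0 //.
suff : 1 - eta <= prob_recover a b n (lam n) (K n) by lra.
have M1 : 1 <= M by rewrite /M; lra.
have n1 : 1 <= n%:R :> R by apply: le_trans nM; exact: exprn_ege1.
have n0 : (0 < n)%N by rewrite -(ltr_nat R); lra.
set D := Dlam n (lam n) in hKn.
(* If [D <= 1], then [ln D = 0] and [ln 0 = 0] by convention, so [K = 0] and isolation is
   vacuous. *)
have [D1|D2] := leqP D 1.
  have : (K n)%:R <= 0 :> R.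
    have lnD0 : ln D%:R = 0 :> R.
      by case: (D) D1 => [|[|]] // _; rewrite ?ln1 // ln0.
    by move: hKn; rewrite lnD0 ln0 // mulr0.
  rewrite lern0 => /eqP ->.
  apply: (@le_trans _ _ (1 - 0)); first by lra.
  apply: prob_recover_ge => //; rewrite mul0r eq_card0 // => sig.
  by rewrite !inE; apply/negbTE; rewrite negbK; apply/forallP => -[].
have [t _] : exists t : tabloid n (lam n), t \in [set: tabloid n (lam n)]%SET.
  by apply/card_gt0P; rewrite cardsT; exact: ltnW D2.
set m := (n - head 0%N (lam n))%N in hm.
have m0 : (0 < m)%N.
  by case: posnP => // m0; move: D2; rewrite ltnNge (leq_trans (Dlam_le n (lam n))) // -/m m0.
pose z : R := n%:R `^ 36^-1.
have NE : n%:R = z ^+ 36 by rewrite -powR_mulrn ?powR_ge0 // -powRrM mulVf ?powRr1.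
have zM : M <= z.
  rewrite leNgt; apply/negP => zM; move: nM; rewrite NE leNgt => /negP; apply.
  by apply: ltrXn2r => //; rewrite ?powR_ge0.
have mz : m%:R <= z ^+ 8.
  apply: le_trans hm _; rewrite -powR_mulrn ?powR_ge0 // -powRrM ler_powR //.
  have -> : 36^-1 * 8 = 2 / 9 :> R by field.
  lra.
have nmD : n%:R - m%:R <= D%:R :> R.
  by rewrite lerBlDr -natrD ler_nat addnC -leq_subLR; exact: Dlam_ge.
have z1 : 1 <= z by exact: le_trans zM.
have z8 : 8 <= z by apply: le_trans zM; rewrite /M; lra.
(* Here [2 m <= 2 z^8 <= z^9 <= n], so [D >= n - m >= n / 2]. *)
have zD36 : z ^+ 36 <= D%:R * 2.
  have : 2 * z ^+ 8 <= z ^+ 36.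
    apply: (@le_trans _ _ (z ^+ 9)); last by apply: ler_weXn2l => //; lra.
    rewrite [leRHS]exprS; apply: ler_wpM2r; last lra.
    by rewrite exprn_ge0 // powR_ge0.
  rewrite -NE in nmD *; lra.
have zD : z <= D%:R * 2.
  by apply: le_trans zD36; rewrite -[leLHS]expr1; apply: ler_weXn2l => //; lra.
have D4 : 4 <= D%:R :> R by lra.
have D0 : 0 < D%:R :> R by lra.
have lnD : 1 <= ln D%:R :> R.
  by rewrite -[leLHS]expRK ler_ln ?posrE ?expR_gt0 //; apply: le_trans (expR1_le4 R) D4.
have lnDm : ln D%:R <= m%:R * ln n%:R :> R.
  have n0R : 0 < n%:R :> R by rewrite ltr0n.
  rewrite mulr_natl -lnXn // ler_ln ?posrE ?exprn_gt0 //.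
  by rewrite -natrX ler_nat; exact: Dlam_le.
pose L := (Num.truncn (3 * ln D%:R ^+ 2 : R)).+1.
have L3 : 3 * ln D%:R ^+ 2 <= L%:R :> R by apply/ltW/truncnS_gt.
have LD : L%:R <= 3 * ln D%:R ^+ 2 + 1 :> R.
  by rewrite /L -natr1 lerD2r truncn_le // mulr_ge0 // exprn_ge0 //; lra.
have cz : 32 * 36 ^+ 2 / c <= z by apply: le_trans zM; rewrite /M; lra.
have small := error_bound c0 z1 cz (ler0n _ m) mz NE lnD zD36 lnDm (ler0n _ L) LD.
have hKc : (K n)%:R <= (1 - c) * D%:R * ln (ln D%:R).
  apply: le_trans hKn _; rewrite -!mulrA ler_wpM2r ?mulr_ge0 ?ln_ge0 ?ler0n //.
  by rewrite lerB // ge_min lexx.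
apply: le_trans (prob_recover_bound ha hab c0 c1 n0 lnD hKc L3 small).
rewrite lerB //.
have e2 : 2 <= eta * z.
  have : 2 / eta <= z by apply: le_trans zM; rewrite /M; lra.
  by rewrite ler_pdivrMr // mulrC.
rewrite -[leLHS]mul1r ler_pdivrMr //.
have : eta * z <= eta * (D%:R * 2) by rewrite ler_wpM2l // ltW.
lra.
Unshelve. all: by end_near.
Qed.
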